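(* Let $\Gamma=(V_\Gamma,E_\Gamma,s,t)$ be a finite strongly connected $k$-out graph without parallel edges and without loops, and let $H$ be a nontrivial finite group. Assume that $|V_\Gamma|\ge d(H)$. Let $\Gamma^\sharp$ be the graph obtained from $\Gamma$ by adding exactly one loop at every vertex. Then there exist a finite strongly connected $(k+1)$-out graph $G$ and a graph congruence $\rho$ on $G$ such that \[ G/\rho\cong \Gamma^\sharp,\qquad \operatorname{Aut}(G)\cong H, \] and $G$ is not totally synchronizing.
   Context: A graph is a finite directed multigraph $G=(V,E,s,t)$ with source and target maps $s,t:E\to V$ (in general loops and parallel edges, i.e. distinct edges with the same source and the same target, are allowed). It is $k$-out if every vertex has exactly $k$ outgoing edges. An isomorphism of graphs is a pair of bijections on vertices and on edges commuting with $s$ and $t$; $\operatorname{Aut}(G)$ is the group of automorphisms. $d(H)$ denotes the minimal size of a generating set of the group $H$. Given an equivalence relation $\rho$ on $V(G)$, the quotient $G/\rho$ has vertex set $V(G)/\rho$ and, for each pair of classes $C,D$, exactly $\max_{p\in C}|\{e\in E: s(e)=p,\ t(e)\in D\}|$ parallel edges from $C$ to $D$. For a $k$-out graph $G$, $\rho$ is a (graph) congruence if $G/\rho$ is again $k$-out; equivalently, for all classes $C,D$ all vertices of $C$ have the same number of outgoing edges ending in $D$. A coloring of a $k$-out graph $G$ is a map $\chi:E\to[k]=\{1,\dots,k\}$ whose restriction to the set of outgoing edges of each vertex is a bijection onto $[k]$. It defines the deterministic complete automaton $\chi(G)=(V,[k],\delta_\chi)$, where $\delta_\chi(v,a)=t(e)$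 for the unique edge $e$ with $s(e)=v$, $\chi(e)=a$. The automaton is synchronizing if there is a word $w\in[k]^*$ with $|V\cdot w|=1$. $G$ is totally synchronizing if $\chi(G)$ is synchronizing for every coloring $\chi$ of $G$. *)

(* Defs.v *)
(* MathComp world. *)
From HB Require Import structures.
From mathcomp Require Import all_boot all_fingroup all_solvable.

Set Implicit Arguments.
Unset Strict Implicit.
Unset Printing Implicit Defensive.

Record digraph := Digraph {
  vert : finType;
  edge : finType;
  src : edge -> vert;
  tgt : edge -> vert
}.

Definition out_edges (G : digraph) (v : vert G) : {set edge G} :=
  [set e | src e == v].

Definition out_regular (k : nat) (G : digraph) : Prop :=
  forall v : vert G, #|out_edges v| = k.

Definition adjacent (G : digraph) : rel (vert G) :=
  fun u v => [exists e : edge G, (src e == u) && (tgt e == v)].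

Definition strongly_connected (G : digraph) : Prop :=
  forall u v : vert G, connect (@adjacent G) u v.

Definition no_parallel_edges (G : digraph) : Prop :=
  forall e f : edge G, src e = src f -> tgt e = tgt f -> e = f.

Definition loopless (G : digraph) : Prop :=
  forall e : edge G, src e <> tgt e.

Definition add_loops (G : digraph) : digraph :=
  @Digraph (vert G) (edge G + vert G)%type
    (fun x => match x with inl e => src e | inr v => v end)
    (fun x => match x with inl e => tgt e | inr v => v end).

Definition graph_iso (G G' : digraph) : Prop :=
  exists (f : vert G -> vert G') (g : edge G -> edge G'),
    [/\ bijective f, bijective g,
        forall e, src (g e) = f (src e) & forall e, tgt (g e) = f (tgt e)].

Definition graph_aut_set (G : digraph) :
    {set ({perm vert G} * {perm edge G})%type} :=
  [set p : {perm vert G} * {perm edge G} | [forall e : edge G,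
     (src (p.2 e) == p.1 (src e)) && (tgt (p.2 e) == p.1 (tgt e))]].

Lemma graph_aut_group_set (G : digraph) : group_set (graph_aut_set G).
Proof.
apply/group_setP; split=> [|p q].
  by rewrite inE; apply/forallP=> e; rewrite !perm1 !eqxx.
rewrite !inE => /forallP Hp /forallP Hq; apply/forallP=> e /=.
have /andP[/eqP ps /eqP pt] := Hp e.
have /andP[/eqP qs /eqP qt] := Hq (p.2 e).
by rewrite !permM qs qt ps pt !eqxx.
Qed.

Definition graph_aut (G : digraph) :
    {group ({perm vert G} * {perm edge G})%type} :=
  Group (graph_aut_group_set G).

Section Quotient.

Variables (G : digraph) (rho : rel (vert G)).

(* The finite type of equivalence classes, when rho is an equivalence. *)
Definition quot_vert : finType :=
  {C : {set vert G} | C \in equivalence_partition rho [set: vert G]}.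

Definition edges_into (p : vert G) (D : {set vert G}) : nat :=
  #|[set e : edge G | (src e == p) && (tgt e \in D)]|.

Definition quot_mult (C D : quot_vert) : nat :=
  \max_(p in val C) edges_into p (val D).

(* An edge from C to D is an index below [quot_mult C D]. *)
Definition quot_edge : finType :=
  {CD : quot_vert * quot_vert & 'I_(quot_mult CD.1 CD.2)}.

Definition quotient_graph : digraph :=
  @Digraph quot_vert quot_edge (fun x => (tag x).1) (fun x => (tag x).2).

End Quotient.

Definition congruence (k : nat) (G : digraph) (rho : rel (vert G)) : Prop :=
  equivalence_rel rho /\ out_regular k (quotient_graph rho).

(* Colors are numbered 0, ..., k-1 instead of 1, ..., k. *)
Definition coloring (k : nat) (G : digraph) (chi : edge G -> 'I_k) : Prop :=
  forall v : vert G,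
    {in out_edges v &, injective chi} /\ chi @: out_edges v = [set: 'I_k].

(* The default value v is never used when chi is a coloring. *)
Definition delta (k : nat) (G : digraph) (chi : edge G -> 'I_k)
    (v : vert G) (a : 'I_k) : vert G :=
  if [pick e in out_edges v | chi e == a] is Some e then tgt e else v.

Definition synchronizing (Q A : finType) (step : Q -> A -> Q) : Prop :=
  exists w : seq A, #|[set foldl step q w | q in [set: Q]]| = 1.

Definition totally_synchronizing (k : nat) (G : digraph) : Prop :=
  forall chi : edge G -> 'I_k, coloring chi -> synchronizing (delta chi).

(* Main.v *)
(* [G] is a cover of [Gamma] with loops on which [H] acts freely.  The vertices
   over the [r]-th vertex [v] of [Gamma] are the triples [(v, i, h)] with
   [i <= r]; an edge [v -> w] of [Gamma] lifts to [(v, i, h) -> (w, 0, h)], and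
   the loop at [v] to the chain [(v, i, h) -> (v, i + 1, h)], closed up by
   [(v, r, h) -> (v, 0, g_v h)], where the [g_v] generate [H].  Then [H] acts on
   the right, and connectivity comes from the [g_v].  When [Gamma] has at least
   two vertices, level [0] is characterised by in-degree at least [2], so an
   automorphism maps chains to chains of the same length; as the lengths are
   pairwise distinct it preserves [v] and [i], hence is given by [H].  Colouring
   edges by the fibre they enter makes every letter commute with the free action
   of [H], so no word is a reset word. *)
Require Import Defs.
From mathcomp Require Import all_boot all_fingroup all_solvable.

Set Implicit Arguments.
Unset Strict Implicit.
Unset Printing Implicit Defensive.

(** * Simple digraphs given by relations, and their automorphism groups *)

Section SimpleGraphs.

(** Without parallel edges an edge is determined by its two ends, so a vertex bijection compatible
    with adjacency forces the edge bijection. *)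
Lemma simple_graph_iso (G G' : digraph) (f : vert G -> vert G')
    (f' : vert G' -> vert G) :
  cancel f f' -> cancel f' f ->
  no_parallel_edges G -> no_parallel_edges G' ->
  (forall u v, adjacent u v = adjacent (f u) (f v)) -> graph_iso G G'.
Proof.
move=> fK f'K simG simG' adjE.
have exg (e : edge G) :
    exists e', (src e' == f (src e)) && (tgt e' == f (tgt e)).
  by apply/existsP; rewrite -[[exists _, _]]adjE; apply/existsP; exists e;
    rewrite !eqxx.
have exg' (e' : edge G') :
    exists e, (src e == f' (src e')) && (tgt e == f' (tgt e')).
  apply/existsP; rewrite -[[exists _, _]]/(adjacent _ _) adjE !f'K.
  by apply/existsP; exists e'; rewrite !eqxx.
pose g e := xchoose (exg e); pose g' e' := xchoose (exg' e').
have gP e : src (g e) = f (src e) /\ tgt (g e) = f (tgt e).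
  by have /andP[/eqP ? /eqP] := xchooseP (exg e).
have g'P e' : src (g' e') = f' (src e') /\ tgt (g' e') = f' (tgt e').
  by have /andP[/eqP ? /eqP] := xchooseP (exg' e').
exists f, g; split; [by exists f' | | by move=> e; case: (gP e)..].
exists g' => e.
  have [sg tg] := gP e; have [sg' tg'] := g'P (g e).
  by apply: simG; rewrite ?sg' ?tg' ?sg ?tg fK.
have [sg' tg'] := g'P e; have [sg tg] := gP (g' e).
by apply: simG'; rewrite ?sg ?tg ?sg' ?tg' f'K.
Qed.

Lemma card_out_edges_simple (G : digraph) (v : vert G) :
  no_parallel_edges G -> #|out_edges v| = #|[set w | adjacent v w]|.
Proof.
move=> simG; rewrite -(card_in_imset (f := @tgt G) (D := out_edges v)).
  apply: eq_card => w; rewrite inE; apply/imsetP/existsP.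
    by case=> e; rewrite inE => sv ->; exists e; rewrite sv eqxx.
  by case=> e /andP[sv /eqP<-]; exists e; rewrite ?inE.
by move=> e f; rewrite !inE => /eqP<- /eqP/esym; apply: simG.
Qed.

Lemma add_loops_simple (G : digraph) :
  no_parallel_edges G -> loopless G -> no_parallel_edges (add_loops G).
Proof.
move=> simG llG [e|u] [f|v] //=; last by move=> ->.
- by move=> se te; rewrite (simG e f).
- by move=> se te; case: (llG e); rewrite se.
- by move=> se te; case: (llG f); rewrite -se.
Qed.

Lemma adjacent_add_loops (G : digraph) (u v : vert G) :
  @adjacent (add_loops G) u v = (v == u) || adjacent u v.
Proof.
apply/existsP/orP=> [[[e|w] /= /andP[/eqP su /eqP tv]]|[/eqP->|/existsP[e sv]]].
- by right; apply/existsP; exists e; rewrite su tv !eqxx.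
- by left; rewrite -su -tv.
- by exists (inr u); rewrite /= !eqxx.
- by exists (inl e).
Qed.

Definition rel_graph (T : finType) (r : rel T) : digraph :=
  @Digraph T {xy : T * T | r xy.1 xy.2}
    (fun e => (val e).1) (fun e => (val e).2).

Variables (T : finType) (r : rel T).

Lemma rel_graph_simple : no_parallel_edges (rel_graph r).
Proof.
move=> e f /= se te; apply: val_inj.
by rewrite [LHS]surjective_pairing se te -surjective_pairing.
Qed.

Lemma rel_edgeP (x y : T) : r x y -> exists2 e : edge (rel_graph r),
  src e = x & tgt e = y.
Proof. by move=> rxy; exists (exist _ (x, y) rxy). Qed.

Lemma adjacent_rel_graph : @adjacent (rel_graph r) =2 r.
Proof.
move=> x y; apply/existsP/idP => [[e /andP[/eqP<- /eqP<-]]|/rel_edgeP[e <- <-]].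
  exact: (valP e).
by exists e; rewrite !eqxx.
Qed.

Lemma rel_graph_connected :
  (forall x y, connect r x y) -> strongly_connected (rel_graph r).
Proof. by move=> r_conn x y; rewrite (eq_connect adjacent_rel_graph). Qed.

Lemma graph_aut_rel (p : {perm vert (rel_graph r)})
    (q : {perm edge (rel_graph r)}) :
  (p, q) \in graph_aut (rel_graph r) -> forall x y, r (p x) (p y) = r x y.
Proof.
(* The converse implication comes from the inverse automorphism. *)
suff half p' q' : (p', q') \in graph_aut (rel_graph r) ->
    forall x y, r x y -> r (p' x) (p' y).
  move=> pqA x y; apply/idP/idP; last exact: half pqA _ _.
  have := pqA; rewrite -groupV => /half half' /half'.
  by rewrite !permK.
rewrite inE => /forallP pq x y /rel_edgeP[e <- <-].
have /andP[/eqP<- /eqP<-] := pq e; exact: (valP (q' e)).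
Qed.

Variables (K : finGroupType) (act : K -> T -> T).
Hypothesis act1 : act 1%g =1 id.
Hypothesis actM : forall h h' x, act (h * h')%g x = act h' (act h x).
Hypothesis act_rel : forall h x y, r x y -> r (act h x) (act h y).

Definition act_edge h (e : edge (rel_graph r)) : edge (rel_graph r) :=
  exist _ (act h (src e), act h (tgt e)) (act_rel h (valP e)).

Lemma act_inj h : injective (act h).
Proof. by move=> x y /(congr1 (act h^-1)); rewrite -!actM mulgV !act1. Qed.

Lemma act_edge_inj h : injective (act_edge h).
Proof.
move=> e f [/act_inj se /act_inj te]; exact: rel_graph_simple.
Qed.

Definition act_aut h := (perm (@act_inj h), perm (@act_edge_inj h)).

(** [actM] describes a right action, in agreement with [permM], which applies the left factor
    first. *)
Lemma act_aut_morphic : {in [set: K] &, {morph act_aut : h h' / (h * h')%g}}.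
Proof.
move=> h h' _ _; congr (_, _); apply/permP=> x; rewrite permM !permE ?actM //.
by apply: rel_graph_simple; rewrite /= actM.
Qed.

(** Freeness at one point makes [act_aut] injective. Rigidity on vertices makes it onto, because the
    vertex part of an automorphism of a simple graph determines the edge part. *)
Lemma graph_aut_rel_isog (x0 : T) :
  (forall h h', act h x0 = act h' x0 -> h = h') ->
  (forall p : {perm T}, (forall x y, r (p x) (p y) = r x y) ->
     exists h, p =1 act h) ->
  [set: K]%g \isog graph_aut (rel_graph r).
Proof.
move=> free rigid; apply/isogP; exists (Morphism act_aut_morphic).
  apply/injmP => h h' _ _ [/permP/(_ x0) + _] /=.
  by rewrite !permE => /free.
apply/setP=> -[p q]; rewrite morphimEdom; apply/imsetP/idP=> [[h _ ->]|pqA].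
  by rewrite inE; apply/forallP=> e; rewrite !permE !eqxx.
have [h ph] := rigid p (graph_aut_rel pqA); exists h => //.
congr (_, _); apply/permP=> x; rewrite permE ?ph //.
move: pqA; rewrite inE => /forallP/(_ x)/andP[/eqP sx /eqP tx].
by apply: rel_graph_simple; rewrite ?sx ?tx ph.
Qed.

End SimpleGraphs.

(** * Automata of colorings, and an obstruction to synchronization *)

Section Colorings.

Variables (k : nat) (G : digraph) (chi : edge G -> 'I_k).
Hypothesis chi_col : coloring chi.

Lemma delta_edge (e : edge G) : delta chi (src e) (chi e) = tgt e.
Proof.
rewrite /delta; case: pickP => [f /andP[fs /eqP cf]|/(_ e)]; last first.
  by rewrite inE !eqxx.
have [inj _] := chi_col (src e).
by congr tgt; apply: inj cf => //; rewrite inE.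
Qed.

Lemma color_edgeP (v : vert G) (c : 'I_k) :
  exists2 e : edge G, src e = v & chi e = c.
Proof.
have [_ /setP/(_ c)] := chi_col v; rewrite [RHS]inE => /imsetP[e].
by rewrite inE => /eqP sv ->; exists e.
Qed.

Lemma delta_aut (f : vert G -> vert G) (g : edge G -> edge G) :
  (forall e, src (g e) = f (src e)) -> (forall e, tgt (g e) = f (tgt e)) ->
  (forall e, chi (g e) = chi e) ->
  forall v c, delta chi (f v) c = f (delta chi v c).
Proof.
move=> sg tg cg v c; have [e <- <-] := color_edgeP v c.
by rewrite delta_edge -sg -(cg e) delta_edge.
Qed.

End Colorings.

(** If [w] sends every state to [q0], it sends [f q0] to [q0]; since [f] commutes with [w], it also
    sends [f q0] to [f q0]. *)
Lemma not_synchronizing (Q A : finType) (step : Q -> A -> Q) (f : Q -> Q) :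
  (forall q a, step (f q) a = f (step q a)) -> (forall q, f q <> q) ->
  ~ synchronizing step.
Proof.
move=> fstep free [w /eqP/cards1P[q0 Qw]].
have imQ q : foldl step q w = q0.
  by apply/set1P; rewrite -Qw; apply/imsetP; exists q; rewrite ?inE.
have fw q : foldl step (f q) w = f (foldl step q w).
  by elim: w q {Qw imQ} => //= a w IHw q; rewrite fstep.
by apply: (free q0); rewrite -{1}(imQ q0) -fw imQ.
Qed.

(** * Lifts of a relation to a fibred set, and the quotient by the fibres *)

Section Lift.

Variables (T V : finType) (N : rel V) (fib : T -> V) (step : T -> V -> T).
Variable (sec : V -> T).
Hypothesis fib_sec : cancel sec fib.
Hypothesis fib_step : forall x, cancel (step x) fib.

(** Unique lifting: for each neighbour [w] of [fib x], exactly one edge leaves [x] towards the fibre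
    of [w], and it ends at [step x w]. *)
Definition lift_rel : rel T :=
  fun x y => N (fib x) (fib y) && (y == step x (fib y)).

Local Notation G := (rel_graph lift_rel).
Local Notation rho := (fun x y : vert G => fib x == fib y).

Lemma lift_rel_step x w : lift_rel x (step x w) = N (fib x) w.
Proof. by rewrite /lift_rel fib_step eqxx andbT. Qed.

Lemma lift_relP x y : reflect (exists2 w, N (fib x) w & y = step x w)
  (lift_rel x y).
Proof.
apply: (iffP andP) => [[Nxy /eqP yE]|[w Nxw ->]]; first by exists (fib y).
by rewrite fib_step.
Qed.

Lemma lift_edges_inj (e f : edge G) :
  src e = src f -> fib (tgt e) = fib (tgt f) -> e = f.
Proof.
move=> sef tef; apply: rel_graph_simple => //.
have /andP[_ /eqP te] := valP e; have /andP[_ /eqP tf] := valP f.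
by rewrite /= te tf; rewrite /= in sef tef; rewrite sef tef.
Qed.

Lemma edges_into_fibre (x : T) (v : V) :
  @edges_into G x [set y | v == fib y] = N (fib x) v.
Proof.
rewrite /edges_into; case Nxv: (N (fib x) v); last first.
  apply/eqP; rewrite cards_eq0 -subset0; apply/subsetP=> e; rewrite !inE.
  move=> /andP[/eqP sx /eqP tv].
  have /andP[+ _] := valP e; rewrite -[(val e).1]/(src e) -[(val e).2]/(tgt e).
  by rewrite sx -tv Nxv.
have /rel_edgeP[e se te] : lift_rel x (step x v) by rewrite lift_rel_step.
apply/eqP/cards1P; exists e; apply/setP=> f; rewrite !inE.
apply/idP/eqP=> [/andP[/eqP sx /eqP tv]|->].
  by apply: lift_edges_inj; rewrite ?sx ?te -?tv ?fib_step.
by rewrite se te fib_step !eqxx.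
Qed.

(** The section [sec] makes every fibre nonempty, hence a genuine class. *)
Lemma fibre_class (v : V) :
  [set y | v == fib y] \in equivalence_partition rho [set: vert G].
Proof.
apply/imsetP; exists (sec v); rewrite ?inE //.
by apply/setP=> y; rewrite !inE fib_sec.
Qed.

Definition fibre (v : V) : quot_vert rho :=
  exist (fun C => C \in equivalence_partition rho [set: vert G])
    [set y | v == fib y] (fibre_class v).

Lemma fibre_surj (C : quot_vert rho) : exists v, fibre v == C.
Proof.
have /imsetP[x _ Cx] := valP C; exists (fib x).
by rewrite -val_eqE /= [val C in eqbRHS]Cx; apply/eqP/setP=> y; rewrite !inE.
Qed.

Definition class_base (C : quot_vert rho) : V := xchoose (fibre_surj C).

Lemma class_baseK : cancel class_base fibre.
Proof. by move=> C; apply/eqP/(xchooseP (fibre_surj C)). Qed.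

Lemma fibreK : cancel fibre class_base.
Proof.
move=> v; have /(congr1 val)/setP/(_ (sec v)) := class_baseK (fibre v).
by rewrite !inE fib_sec eqxx => /eqP.
Qed.

(** By unique lifting all terms of the maximum equal [N v w], read as 0 or 1; the point [sec v]
    shows that the maximum is not over an empty set. *)
Lemma quot_mult_fibre (v w : V) : quot_mult (fibre v) (fibre w) = N v w.
Proof.
apply/eqP; rewrite eqn_leq; apply/andP; split.
  apply/bigmax_leqP=> x; rewrite inE => /eqP->.
  by rewrite edges_into_fibre.
rewrite -{1}(fib_sec v) -edges_into_fibre.
by apply: leq_bigmax_cond; rewrite inE fib_sec.
Qed.

Lemma quotient_simple : no_parallel_edges (quotient_graph rho).
Proof.
move=> [[C D] i] [[C' D'] j] /= eC eD; subst C' D'; congr existT; apply: ord_inj.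
(* With multiplicities at most 1, both edge indices are 0. *)
have le1: quot_mult C D <= 1.
  by rewrite -(class_baseK C) -(class_baseK D) quot_mult_fibre leq_b1.
by case: i j => [[|i] Hi] [[|j] Hj] //=;
  have := leq_trans Hi le1; have := leq_trans Hj le1.
Qed.

Lemma adjacent_quotient (v w : V) :
  @adjacent (quotient_graph rho) (fibre v) (fibre w) = N v w.
Proof.
rewrite -[RHS]lt0b -quot_mult_fibre; apply/existsP/idP.
  by move=> [[[C D] i] /= /andP[/eqP<- /eqP<-]]; apply: leq_ltn_trans (ltn_ord i).
by move=> lt0; exists (Tagged (fun CD => 'I_(quot_mult CD.1 CD.2))
  (Ordinal lt0 : 'I_(quot_mult (fibre v, fibre w).1 (fibre v, fibre w).2)));
  rewrite /= !eqxx.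
Qed.

Variable k : nat.
Hypothesis card_N : forall v, #|[set w | N v w]| = k.

Lemma lift_out_regular : out_regular k G.
Proof.
move=> x; rewrite card_out_edges_simple; last exact: rel_graph_simple.
rewrite -(card_N (fib x)) -(card_imset _ (can_inj (@fib_step x))).
apply: eq_card => y; rewrite inE adjacent_rel_graph.
apply/lift_relP/imsetP=> [[w Nw ->]|[w Nw ->]]; exists w => //.
  by rewrite inE.
by rewrite inE in Nw.
Qed.

Lemma lift_congruence : congruence k rho.
Proof.
split; first by move=> x y z; rewrite eqxx; split=> // /eqP->.
move=> C; rewrite card_out_edges_simple; last exact: quotient_simple.
rewrite -(class_baseK C) -(card_N (class_base C)).
rewrite -(card_imset _ (can_inj fibreK)).
apply: eq_card => D; rewrite inE -(class_baseK D) adjacent_quotient.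
by rewrite mem_imset ?inE //; apply: can_inj fibreK.
Qed.

Lemma quotient_iso (G' : digraph) (f : V -> vert G') (f' : vert G' -> V) :
  cancel f f' -> cancel f' f -> no_parallel_edges G' ->
  (forall v w, N v w = adjacent (f v) (f w)) ->
  graph_iso (quotient_graph rho) G'.
Proof.
move=> fK f'K simG' NE.
apply: (@simple_graph_iso (quotient_graph rho) G'
  (f \o class_base) (fibre \o f')) => //.
- by move=> C /=; rewrite fK class_baseK.
- by move=> v /=; rewrite fibreK f'K.
- exact: quotient_simple.
by move=> C D /=; rewrite -NE -adjacent_quotient !class_baseK.
Qed.

Definition nbr_index (v w : V) : nat := index w (enum [set w | N v w]).

Lemma nbr_index_lt (v w : V) : N v w -> nbr_index v w < k.
Proof. by move=> Nvw; rewrite -(card_N v) cardE index_mem mem_enum inE. Qed.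

Lemma edge_N (e : edge G) : N (fib (src e)) (fib (tgt e)).
Proof. by have /andP[] := valP e. Qed.

Definition target_color (e : edge G) : 'I_k := Ordinal (nbr_index_lt (edge_N e)).

(** Edges leaving [x] with equal colours enter the same fibre, so they coincide by unique
    lifting. *)
Lemma target_color_coloring : coloring target_color.
Proof.
move=> x; have inj: {in out_edges x &, injective target_color}.
  move=> e f; rewrite !inE => /eqP se /eqP sf /(congr1 val).
  change (nbr_index (fib (src e)) (fib (tgt e)) =
    nbr_index (fib (src f)) (fib (tgt f)) -> e = f).
  rewrite /nbr_index se sf => /(index_inj (fib x)) tE.
  apply: lift_edges_inj; first by rewrite se sf.
  by apply: tE; rewrite mem_enum inE; [rewrite -se | rewrite -sf]; apply: edge_N.
(* An injection from [k] outgoing edges into [k] colours is onto. *)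
split=> //; apply/eqP; rewrite eqEcard subsetT cardsT card_ord.
by rewrite (card_in_imset inj) lift_out_regular leqnn.
Qed.

(* The colour of an edge only depends on its image in the base, so a fixed
   point free automorphism over the base commutes with all letters. *)
Lemma lift_not_totally_synchronizing (f : T -> T) :
  (forall x, fib (f x) = fib x) ->
  (forall x w, step (f x) w = f (step x w)) ->
  (forall x, f x <> x) -> ~ totally_synchronizing k G.
Proof.
move=> fib_f step_f free /(_ _ target_color_coloring).
have f_rel (e : edge G) : lift_rel (f (src e)) (f (tgt e)).
  have /andP[Ne /eqP te] := valP e.
  by rewrite /lift_rel !fib_f step_f edge_N -te eqxx.
apply: not_synchronizing (free) => q a.
apply: (delta_aut target_color_coloring (f := f)
  (g := fun e => exist _ (f (src e), f (tgt e)) (f_rel e))) => // e.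
by apply: ord_inj; rewrite /= !fib_f.
Qed.

End Lift.

(** * The cover by chains, and the action of the group on it *)

Section Cover.

Variables (V : finType) (a : rel V) (K : finGroupType) (g : V -> K).

Local Notation rk v := (nat_of_ord (enum_rank v)).

Lemma rk_inj (v w : V) : rk v = rk w -> v = w.
Proof. by move/ord_inj/enum_rank_inj. Qed.

(* Over [v] lie the vertices [(v, i, h)] with [i <= rk v]: fibres have pairwise
   distinct sizes over [K]. *)
Definition cover : finType :=
  {x : V * 'I_#|V| * K | x.1.2 <= enum_rank x.1.1}.

Definition base (x : cover) : V := (val x).1.1.
Definition level (x : cover) : nat := (val x).1.2.
Definition volt (x : cover) : K := (val x).2.

Lemma level_le x : level x <= rk (base x).
Proof. exact: (valP x). Qed.

Lemma cover_eq x y :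
  base x = base y -> level x = level y -> volt x = volt y -> x = y.
Proof.
move=> eb /ord_inj el ev; apply: val_inj.
rewrite [LHS]surjective_pairing [RHS]surjective_pairing; congr (_, _) => //.
by rewrite [LHS]surjective_pairing [RHS]surjective_pairing; congr (_, _).
Qed.

Lemma node_subproof (v : V) (i : nat) : minn i (rk v) < #|V|.
Proof. exact: leq_ltn_trans (geq_minr _ _) (ltn_ord _). Qed.

(* Levels above [rk v] are truncated to [rk v]. *)
Definition node (v : V) (i : nat) (h : K) : cover :=
  exist (fun x : V * 'I_#|V| * K => x.1.2 <= enum_rank x.1.1)
    (v, Ordinal (node_subproof v i), h) (geq_minr _ _).

Lemma base_node v i h : base (node v i h) = v. Proof. by []. Qed.
Lemma volt_node v i h : volt (node v i h) = h. Proof. by []. Qed.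
Lemma level_node v i h : i <= rk v -> level (node v i h) = i.
Proof. by move=> /minn_idPl. Qed.

Lemma nodeE x : node (base x) (level x) (volt x) = x.
Proof. by apply: cover_eq => //; rewrite level_node ?level_le. Qed.

Definition next (x : cover) : cover :=
  if level x < rk (base x) then node (base x) (level x).+1 (volt x)
  else node (base x) 0 (g (base x) * volt x).

Definition cover_step (x : cover) (w : V) : cover :=
  if w == base x then next x else node w 0 (volt x).

(** This is adjacency in [add_loops] when [a] is adjacency in the base graph. *)
Definition sharp : rel V := fun v w => (w == v) || a v w.

Definition right_mul (h : K) (x : cover) : cover :=
  node (base x) (level x) (volt x * h).

Lemma base_next x : base (next x) = base x.
Proof. by rewrite /next; case: ifP. Qed.

Lemma base_step x : cancel (cover_step x) base.
Proof. by move=> w; rewrite /cover_step; case: eqP => // ->; apply: base_next. Qed.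

Lemma base_mul h x : base (right_mul h x) = base x. Proof. by []. Qed.
Lemma volt_mul h x : volt (right_mul h x) = (volt x * h)%g. Proof. by []. Qed.
Lemma level_mul h x : level (right_mul h x) = level x.
Proof. by rewrite level_node ?level_le. Qed.

Lemma right_mul1 : right_mul 1 =1 id.
Proof. by move=> x; rewrite /right_mul mulg1 nodeE. Qed.

Lemma right_mulM h h' x : right_mul (h * h') x = right_mul h' (right_mul h x).
Proof. by apply: cover_eq; rewrite ?level_mul // !volt_mul mulgA. Qed.

Lemma right_mul_node h v i h' : right_mul h (node v i h') = node v i (h' * h).
Proof. by apply: cover_eq; rewrite ?level_mul. Qed.

(** Closing a chain multiplies by [g] on the left while the group acts on the right, so the two
    commute by associativity. *)
Lemma next_mul h x : next (right_mul h x) = right_mul h (next x).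
Proof.
rewrite /next base_mul volt_mul level_mul.
by case: ifP; rewrite right_mul_node ?mulgA.
Qed.

Lemma step_mul h x w :
  cover_step (right_mul h x) w = right_mul h (cover_step x w).
Proof.
by rewrite /cover_step base_mul next_mul volt_mul; case: eqP; rewrite ?right_mul_node.
Qed.

Lemma right_mul_free h h' x : right_mul h x = right_mul h' x -> h = h'.
Proof. by move=> /(congr1 volt) /mulgI. Qed.

Definition cover_rel : rel cover := lift_rel sharp base cover_step.

Lemma cover_rel_mul h x y :
  cover_rel x y -> cover_rel (right_mul h x) (right_mul h y).
Proof.
case/(lift_relP _ base_step) => w Nw ->.
by rewrite -step_mul /cover_rel lift_rel_step //; apply: base_step.
Qed.

Hypothesis a_irr : irreflexive a.

Lemma cover_rel_next x y :
  base y = base x -> cover_rel x y -> y = next x.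
Proof.
by move=> byx /andP[_ /eqP->]; rewrite byx /cover_step eqxx.
Qed.

Lemma cover_rel_base x y :
  base y <> base x -> cover_rel x y -> y = node (base y) 0 (volt x).
Proof.
by move=> /eqP byx /andP[_ /eqP->]; rewrite {1}/cover_step base_step (negPf byx).
Qed.

Lemma cover_next x : cover_rel x (next x).
Proof. by rewrite /cover_rel /lift_rel /sharp base_next /cover_step !eqxx. Qed.

Lemma cover_node x w : a (base x) w -> cover_rel x (node w 0 (volt x)).
Proof.
move=> axw; rewrite /cover_rel /lift_rel /sharp base_node /cover_step axw orbT.
by case: (w =P base x) axw => [->|_ _]; rewrite ?a_irr ?eqxx.
Qed.

Hypothesis a_conn : forall v w, connect a v w.

(** * Strong connectivity of the cover *)

Section Connected.

Hypothesis g_gen : <<g @: [set: V]>>%g = [set: K]%g.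

Local Notation conn := (connect cover_rel).

Lemma climb v h i : i <= rk v -> conn (node v 0 h) (node v i h).
Proof.
elim: i => // i IHi lt_i; apply: connect_trans (IHi (ltnW lt_i)) _.
have := cover_next (node v i h); rewrite /next level_node ?(ltnW lt_i) //.
by rewrite base_node lt_i; apply: connect1.
Qed.

(** Follow the chain to its top and over, by induction on the number of levels left. *)
Lemma wrap x : conn x (node (base x) 0 (g (base x) * volt x)).
Proof.
have [d] := ubnP (rk (base x) - level x); elim: d x => // d IHd x lt_d.
apply: connect_trans (connect1 (cover_next x)) _.
rewrite /next; case: ifP => // lt_x; apply: IHd.
by rewrite base_node level_node // subnSK.
Qed.

Lemma conn_bases v w h : conn (node v 0 h) (node w 0 h).
Proof.
have /connectP[p] := a_conn v w; elim: p v => /= [v _ -> //|u p IHp v].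
move=> /andP[avu] up lp; apply: connect_trans (IHp u up lp).
by apply: connect1; apply: (@cover_node (node v 0 h)).
Qed.

Lemma conn_volts v w h x : conn (node v 0 h) (node w 0 (x * h)).
Proof.
(* The left factors realized by paths from level 0 over [v] back to it form a subgroup. It contains
   each [g u]: travel to [u], go once round the chain there, and return. *)
pose S := [set x | [forall h, conn (node v 0 h) (node v 0 (x * h))]].
have groupS : group_set S.
  apply/group_setP; split=> [|y z].
    by rewrite inE; apply/forallP=> h'; rewrite mul1g.
  rewrite !inE => /forallP Sy /forallP Sz; apply/forallP=> h'.
  by rewrite -mulgA; apply: connect_trans (Sz h') (Sy _).
suff Sx : x \in S.
  by apply: connect_trans (conn_bases _ _ _); move: Sx; rewrite inE => /forallP.
have: x \in <<g @: [set: V]>>%g by rewrite g_gen inE.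
apply/subsetP; rewrite (gen_subG _ (Group groupS)).
apply/subsetP=> _ /imsetP[u _ ->]; rewrite inE; apply/forallP=> h'.
apply: connect_trans (conn_bases v u h') _.
apply: connect_trans (wrap (node u 0 h')) _; exact: conn_bases.
Qed.

(** Wrap down to level 0, correct base and voltage there, then climb to the level of [y]. *)
Lemma cover_connected x y : conn x y.
Proof.
apply: connect_trans (wrap x) _.
rewrite -[y]nodeE; apply: connect_trans (climb _ (level_le y)).
rewrite -[volt y](mulgKV (g (base x) * volt x)%g); exact: conn_volts.
Qed.

End Connected.

(** * Rigidity: automorphisms of the cover come from the group *)

Section Rigid.

(** An automorphism invariant that separates positive levels from level 0 once the base has two
    vertices. *)
Definition unique_pred (x : cover) : Prop :=
  forall y z, cover_rel y x -> cover_rel z x -> y = z.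

(** Edges between fibres and edges closing a chain all end at level 0, so only the predecessor in
    the chain remains. *)
Lemma level_pos_pred x : 0 < level x -> unique_pred x.
Proof.
suff predE y : cover_rel y x -> 0 < level x ->
    [/\ base y = base x, level x = (level y).+1 & volt y = volt x].
  move=> x_gt0 y z /predE/(_ x_gt0)[by_ ly vy] /predE/(_ x_gt0)[bz lz vz].
  by apply: cover_eq; [rewrite by_ | apply: succn_inj; rewrite -ly | rewrite vy].
move=> yx; have [bxy|/eqP bxy] := eqVneq (base x) (base y); last first.
  by rewrite (cover_rel_base bxy yx) level_node.
rewrite (cover_rel_next bxy yx) base_next /next.
by case: ifP => lt_y; rewrite level_node.
Qed.

Lemma level0_pred x v : v != base x -> level x = 0 -> ~ unique_pred x.
Proof.
move=> vx x0 uniq_x.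
have [u aux] : exists u, a u (base x).
  (* The path from [v] is nonempty since [v] differs from [base x]; its last edge provides [u]. *)
  have /connectP[p] := a_conn v (base x); elim/last_ind: p => [_ eqv|p w _].
    by rewrite eqv eqxx in vx.
  rewrite rcons_path last_rcons => /andP[_ ?] ->.
  by exists (last v p).
have ux: base x <> u by move=> xu; rewrite xu a_irr in aux.
have ypred : cover_rel (node u 0 (volt x)) x.
  suff <- : node (base x) 0 (volt x) = x by apply: (cover_node (x := node _ _ _)).
  by apply: cover_eq; rewrite ?level_node.
(* The top of the chain, with the voltage that becomes [volt x] after closing up. *)
pose z := node (base x) (rk (base x)) ((g (base x))^-1 * volt x).
have zpred : cover_rel z x.
  suff <- : next z = x by apply: cover_next.
  rewrite /next level_node // ltnn base_node volt_node mulKVg.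
  by apply: cover_eq; rewrite ?level_node.
by have /(congr1 base) := uniq_x _ _ ypred zpred; rewrite !base_node => /esym.
Qed.

Section Aut.

Variable p : {perm cover}.
Hypothesis p_aut : forall x y, cover_rel (p x) (p y) = cover_rel x y.

Lemma unique_pred_aut x : unique_pred (p x) -> unique_pred x.
Proof.
by move=> px y z yx zx; apply: (@perm_inj _ p); apply: px; rewrite p_aut.
Qed.

Lemma level_pos_aut x v : v != base x -> 0 < level (p x) -> 0 < level x.
Proof.
move=> vx /level_pos_pred/unique_pred_aut; rewrite lt0n; case: eqP => // x0.
by move/(level0_pred vx x0).
Qed.

End Aut.

(** Climbing from level 0, each image has positive level, so it is reached inside one fibre by a
    chain step. The whole chain of [base x] thus fits into the chain of [base (p x)]. *)
Lemma aut_climb (p : {perm cover}) (v0 v1 : V) :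
  v0 != v1 -> (forall x y, cover_rel (p x) (p y) = cover_rel x y) ->
  forall x, rk (base x) <= rk (base (p x)) /\ level (p x) = level x.
Proof.
move=> v01 p_aut.
have other (v : V) : exists w, w != v.
  by have [<-|] := eqVneq v0 v; [exists v1; rewrite eq_sym | exists v0].
have pV_aut x y : cover_rel (p^-1%g x) (p^-1%g y) = cover_rel x y.
  by rewrite -p_aut !permKV.
have pos x : (0 < level (p x)) = (0 < level x).
  apply/idP/idP; first by have [w] := other (base x); apply: level_pos_aut.
  have [w] := other (base (p x)) => wp; rewrite -{1}[x](permK p).
  exact: level_pos_aut wp.
have climb_p v h i : i <= rk v ->
    base (p (node v i h)) = base (p (node v 0 h)) /\ level (p (node v i h)) = i.
  elim: i => [_|i IHi lt_i].
    by split=> //; apply/eqP; rewrite -leqn0 leqNgt pos level_node.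
  have [bi li] := IHi (ltnW lt_i).
  have nextE : next (node v i h) = node v i.+1 h.
    by rewrite /next level_node ?(ltnW lt_i) // base_node lt_i.
  have := cover_next (node v i h); rewrite nextE -p_aut => pnext.
  have pos_i : 0 < level (p (node v i.+1 h)) by rewrite pos level_node.
  have [bE|/eqP bE] :=
      eqVneq (base (p (node v i.+1 h))) (base (p (node v i h))); last first.
    by rewrite (cover_rel_base bE pnext) level_node in pos_i.
  split; first by rewrite bE.
  move: pos_i; rewrite (cover_rel_next bE pnext) /next.
  by case: ifP => lt_p; rewrite level_node // li.
move=> x; rewrite -[x]nodeE; have [bp lp] := climb_p _ (volt x) _ (level_le x).
rewrite base_node bp lp level_node ?level_le //; split=> //.
(* At the top of its chain, the image has level [rk (base x)], which cannot exceed the rank of its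
   own base. *)
have [bq lq] := climb_p (base x) (volt x) _ (leqnn _).
by rewrite -{1}lq -bq level_le.
Qed.

(** The rank inequalities for [p] and its inverse give equal ranks, and ranks determine base
    vertices. *)
Lemma aut_base_level (p : {perm cover}) :
  (forall x y, cover_rel (p x) (p y) = cover_rel x y) ->
  forall x, base (p x) = base x /\ level (p x) = level x.
Proof.
move=> p_aut x; have [/existsP[v0 /existsP[v1 v01]]|one] :=
    boolP [exists v0 : V, exists v1, v0 != v1].
  have pV_aut y z : cover_rel (p^-1%g y) (p^-1%g z) = cover_rel y z.
    by rewrite -p_aut !permKV.
  have [le_x lx] := aut_climb v01 p_aut x; split=> //; apply: rk_inj.
  apply/eqP; rewrite eqn_leq le_x andbT.
  by have [+ _] := aut_climb v01 pV_aut (p x); rewrite permK.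
have allE (v w : V) : v = w.
  by apply/eqP; apply: contraNT one => vw; apply/existsP; exists v;
    apply/existsP; exists w.
(* Over a single base vertex, levels are bounded by [#|V|], which leaves only 0. *)
have level0 y : level y = 0.
  apply/eqP; rewrite -leqn0 -ltnS; apply: leq_trans (ltn_ord (val y).1.2) _.
  by apply/fintype_le1P => v w; apply: allE.
by split; [apply: allE | rewrite !level0].
Qed.

Hypothesis g_gen : <<g @: [set: V]>>%g = [set: K]%g.

Lemma cover_rigid (x0 : cover) (p : {perm cover}) :
  (forall x y, cover_rel (p x) (p y) = cover_rel x y) ->
  exists h, p =1 right_mul h.
Proof.
move=> p_aut; have pbl := aut_base_level p_aut.
(* As [p] keeps base and level, an edge multiplies the voltages of [x] and [p x] by the same left
   factor, which cancels in [c]. Connectivity then makes [c] constant. *)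
pose c x := ((volt x)^-1 * volt (p x))%g.
have c_rel x y : cover_rel x y -> c x = c y.
  move=> xy; have := xy; rewrite -p_aut => pxy.
  have [[bx lx] [by_ ly]] := (pbl x, pbl y).
  have [bE|/eqP bE] := eqVneq (base y) (base x); last first.
    have bpE : base (p y) <> base (p x) by rewrite by_ bx.
    by rewrite /c (cover_rel_base bpE pxy) (cover_rel_base bE xy).
  have bpE : base (p y) = base (p x) by rewrite by_ bx.
  rewrite /c (cover_rel_next bpE pxy) (cover_rel_next bE xy) /next bx lx.
  by case: ifP; rewrite !volt_node // invMg -mulgA mulKg.
have cE x : c x = c x0.
  have /connectP[q] := cover_connected g_gen x x0.
  elim: q x => [x _ -> //|y q IHq x /= /andP[/c_rel -> yq]]; exact: IHq.
exists (c x0) => x; have [bx lx] := pbl x.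
by apply: cover_eq; rewrite ?level_mul // volt_mul -(cE x) mulKVg.
Qed.

End Rigid.

End Cover.

(** * Generators indexed by vertices, and the final assembly *)

Lemma gen_family (gT : finGroupType) (H : {group gT}) (V : finType) :
  'm(H)%g <= #|V| ->
  exists g : V -> subg_of H, <<g @: [set: V]>>%g = [set: subg_of H]%g.
Proof.
have [B genB <-] := grank_witness H => le_BV.
(* Vertices beyond the size of [B] receive the default value 1. *)
exists (fun v => subg H (nth 1%g (enum B) (enum_rank v))).
have sBH : B \subset H by rewrite -genB subset_gen.
apply/eqP; rewrite -subTset -im_subg -{2}genB morphim_gen ?genS //.
apply/subsetP=> _ /morphimP[x _ Bx ->].
have lt_x : index x (enum B) < #|V|.
  by apply: leq_trans le_BV; rewrite cardE index_mem mem_enum.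
apply/imsetP; exists (enum_val (Ordinal lt_x)); rewrite ?inE //.
by rewrite enum_valK nth_index // mem_enum.
Qed.

Theorem corollary3p25 (k : nat) (Gamma : digraph)
    (gT : finGroupType) (H : {group gT})
    (Gamma_connected : strongly_connected Gamma)
    (Gamma_out : out_regular k Gamma)
    (Gamma_simple : no_parallel_edges Gamma)
    (Gamma_loopless : loopless Gamma)
    (H_nontrivial : H :!=: 1%g)
    (H_rank : ('m(H))%g <= #|vert Gamma|) :
  exists (G : digraph) (rho : rel (vert G)),
    [/\ strongly_connected G,
        out_regular k.+1 G,
        congruence k.+1 rho,
        graph_iso (quotient_graph rho) (add_loops Gamma) &
        (graph_aut G \isog H)%g /\ ~ totally_synchronizing k.+1 G].
Proof.
have [g g_gen] := gen_family H_rank.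
have [h Hh h1] := trivgPn _ H_nontrivial.
(* A nontrivial group needs a generator, so the rank bound yields a vertex. It carries the base
   point at which freeness is tested. *)
have [v0 _] : exists v0 : vert Gamma, v0 \in vert Gamma.
  apply/card_gt0P; apply: leq_trans H_rank; rewrite lt0n.
  have [B genB <-] := grank_witness H; apply: contra H_nontrivial.
  by rewrite cards_eq0 -genB => /eqP->; rewrite gen0.
have a_irr : irreflexive (@adjacent Gamma).
  move=> v; apply/existsP=> -[e /andP[/eqP sv /eqP tv]].
  by apply: (Gamma_loopless e); rewrite sv.
have N_card v : #|[set w | sharp (@adjacent Gamma) v w]| = k.+1.
  have -> : [set w | sharp (@adjacent Gamma) v w] =
      v |: [set w | adjacent v w] by apply/setP=> w; rewrite !inE.
  by rewrite cardsU1 inE a_irr -card_out_edges_simple ?Gamma_out.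
have secK : cancel (fun v => node v 0 1%g) (@base (vert Gamma) (subg_of H)).
  by [].
have stepK := @base_step _ _ g.
exists (rel_graph (cover_rel (@adjacent Gamma) g)), (fun x y => base x == base y).
split.
- exact: rel_graph_connected (cover_connected a_irr Gamma_connected g_gen).
- exact: (lift_out_regular stepK N_card).
- exact: (lift_congruence secK stepK N_card).
- apply: (quotient_iso secK stepK (G' := add_loops Gamma)
    (f := id) (f' := id)) => //.
    exact: add_loops_simple.
  by move=> v w; rewrite adjacent_add_loops.
split.
  rewrite isog_sym; apply: isog_trans (isog_subg H) _.
  apply: (graph_aut_rel_isog (@right_mul1 _ _) (@right_mulM _ _)
    (@cover_rel_mul _ _ _ g) (x0 := node v0 0 1%g)).
    by move=> h1' h2'; apply: right_mul_free.
  by apply: cover_rigid => //; exact: node v0 0 1%g.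
(* Right multiplication by a nontrivial element has no fixed point and preserves fibres. *)
apply: (lift_not_totally_synchronizing stepK N_card
  (f := right_mul (subg H h))) => //.
- by move=> x w; rewrite step_mul.
move=> x; rewrite -[in RHS](right_mul1 x) => /right_mul_free.
by move/(congr1 val); rewrite /= subgK // => h_eq1; rewrite h_eq1 eqxx in h1.
Qed.
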